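(* For every integer $\lambda \in \mathbb{Z}$ and every $\epsilon>0$ there exists $\delta=\delta(\lambda,\epsilon)>0$ such that the following holds: for every sufficiently large prime $p$ there exists a set $A\subset \mathbb{Z}/p\mathbb{Z}$ with $|A|\geq (1/2-\epsilon)p$ such that $|A+\lambda A|\leq (1-\delta)p$.
   Context: For subsets $A,B$ of an abelian group, $A+B=\{a+b: a\in A,\ b\in B\}$, and for an integer $\lambda$, $\lambda A=\{\lambda a: a\in A\}$. *)

(* Defs.v *)
From mathcomp Require Export all_boot all_order all_algebra.
From mathcomp Require Export reals.

Set Implicit Arguments.
Unset Strict Implicit.
Unset Printing Implicit Defensive.

Import GRing.Theory.
Local Open Scope ring_scope.

Definition sumset (G : finZmodType) (A B : {set G}) : {set G} :=
  [set a + b | a in A, b in B].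

Definition dilate (G : finZmodType) (lambda : int) (A : {set G}) : {set G} :=
  [set a *~ lambda | a in A].

(* Main.v *)
Require Import Defs.
From mathcomp Require Import all_boot all_order all_algebra.
From mathcomp Require Import reals.
From mathcomp Require Import zify ring lra.

(**
If [|lambda| <= 1], an interval of length slightly less than [p / 2] works.
Otherwise put [m = - lambda] and [T x = m x], a permutation of [F_p], and let
[B] be a short interval starting at [0].  Let [f x] be the parity of the first
time the [T]-orbit of [x] hits [B], truncated at a time [n] independent of [p].
Then [f (T x) <> f x] unless [x] lies in [B] or its orbit has not hit [B] by
time [n]; the latter is rare, because it forces many base-[q] digits of [x / p]
to be nonzero, where [q] is a power of [m].  As [T] preserves cardinality, the
set of [x] with [f x = 1] and [f (T x) = 0] has density close to [1 / 2].
Remove from it the [x] such that one of [T x, ..., T^(n+1) x] is close to an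
endpoint of [B], so that [f] is unchanged when [T x] is translated by any [c]
in a short interval [C].  If [x] and [y] are in the resulting set [A] and
[c = x + lambda y] is in [C], then [1 = f x = f (T y + c) = f (T y) = 0];
hence [A + lambda A] misses [C].
*)

Set Implicit Arguments.
Unset Strict Implicit.
Unset Printing Implicit Defensive.

Import Order.TTheory GRing.Theory Num.Theory.
Local Open Scope ring_scope.

(** * Parity of the first hitting time of a set *)

Section HittingParity.

Variables (V : finType) (T : V -> V) (B : {set V}) (n : nat).

(* [find] returns [n.+1] on orbits that do not hit [B] by time [n]. *)
Definition hit_parity (x : V) : bool := odd (find (mem B) (traject T x n.+1)).

Definition unhit : {set V} := [set x | ~~ has (mem B) (traject T x n.+1)].

(** One step along the orbit lowers the first hitting time by one, and a hit by time [n] from [x]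
    keeps the truncation from interfering. *)
Lemma hit_parity_step (x : V) :
  x \notin B -> x \notin unhit -> hit_parity (T x) = ~~ hit_parity x.
Proof.
rewrite inE negbK /hit_parity => xB.
rewrite (trajectS T x) [traject T (T x) n.+1]trajectSr /=.
rewrite (negbTE xB) /= => hx.
by rewrite -cats1 find_cat hx negbK.
Qed.

(** The set [F] of odd points and its preimage [F'] have equal size, so their two differences do as
    well. Since parity flips, these differences cover everything outside [B] and [unhit]. *)
Lemma card_hit_parity_descent : injective T ->
  (#|V| <= 2 * #|[set x | hit_parity x && ~~ hit_parity (T x)]|
           + #|B| + #|unhit|)%N.
Proof.
move=> injT; set G := [set x | _].
pose F := [set x | hit_parity x]; pose F' := T @^-1: F.
have cF' : #|F'| = #|F|.
  apply: on_card_preimset; exact: onW_bij (injF_bij injT).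
have cG : #|G| = #|F :\: F'| by apply: eq_card => x; rewrite !inE andbC.
have cG' : #|F' :\: F| = #|F :\: F'|.
  by have := cardsID F' F; have := cardsID F F'; rewrite setIC; lia.
have sub : [set: V] \subset (F :\: F') :|: (F' :\: F) :|: B :|: unhit.
  apply/subsetP => x _; rewrite !in_setU.
  case: (boolP (x \in B)) => [|xB]; first by rewrite !orbT.
  case: (boolP (x \in unhit)) => [|xE]; first by rewrite !orbT.
  by rewrite !inE hit_parity_step //; case: hit_parity.
have := subset_leq_card sub; rewrite cardsT.
have := (leq_card_setU (F :\: F' :|: F' :\: F :|: B) unhit).1.
have := (leq_card_setU (F :\: F' :|: F' :\: F) B).1.
have := (leq_card_setU (F :\: F') (F' :\: F)).1.
by lia.
Qed.

End HittingParity.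

(** * Arcs in ['F_p] *)

Section FpArc.

Variable p : nat.

Definition Fp_arc (a : int) (l : nat) : {set 'F_p} :=
  [set x in [seq (a + j%:Z)%:~R | j <- iota 0 l]].

Lemma Fp_arcP (a : int) (l : nat) (x : 'F_p) :
  reflect (exists2 i : int, a <= i < a + l%:Z & x = i%:~R) (x \in Fp_arc a l).
Proof.
rewrite inE; apply: (iffP mapP) => [[j]|[i i_al ->]].
  by rewrite mem_iota => ? ->; exists (a + j%:Z) => //; lia.
exists `|i - a|%N; first by rewrite mem_iota; lia.
by congr intmul; lia.
Qed.

Lemma card_Fp_arc_le (a : int) (l : nat) : (#|Fp_arc a l| <= l)%N.
Proof.
rewrite cardsE; apply: leq_trans (card_size _) _.
by rewrite size_map size_iota.
Qed.

Lemma card_Fp_arc (a : int) (l : nat) : prime p -> (l <= p)%N -> #|Fp_arc a l| = l.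
Proof.
move=> pr_p le_lp; rewrite cardsE (card_uniqP _) ?size_map ?size_iota //.
rewrite map_inj_in_uniq ?iota_uniq // => i j.
rewrite !mem_iota /= !add0n !rmorphD /= => lt_il lt_jl /addrI.
move/(congr1 val); rewrite /= -!pmulrn !val_Fp_nat // !modn_small //; lia.
Qed.

(** Lift to an integer in [[0, b)] whichever of the two points lies in the arc. The other lift must
    cross [0] or [b], so [u] is within [W] of that endpoint. *)
Lemma Fp_arc_edge (W b : nat) (u : 'F_p) (e : int) : (`|e| <= W)%N ->
  (u \in Fp_arc 0 b) != (u + e%:~R \in Fp_arc 0 b) ->
  u \in Fp_arc (- W%:Z) (2 * W) :|: Fp_arc (b%:Z - W%:Z) (2 * W).
Proof.
move=> eW; rewrite in_setU.
case: (boolP (u \in _)) => [/Fp_arcP[i i_b ui]|uB].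
  move=> /= uB; case: (boolP (0 <= i + e < b%:Z)) => [ie|ie].
    case/negP: uB; apply/Fp_arcP; exists (i + e); first by lia.
    by rewrite ui rmorphD.
  have [lt|ge] := ltP (i + e) 0; apply/orP; [left|right];
    apply/Fp_arcP; exists i => //; lia.
rewrite /= eq_sym eqbF_neg negbK => /Fp_arcP[i i_b ui].
have ue : u = (i - e)%:~R by rewrite rmorphB /= -ui addrK.
case: (boolP (0 <= i - e < b%:Z)) => [ie|ie].
  by case/negP: uB; apply/Fp_arcP; exists (i - e) => //; lia.
have [lt|ge] := ltP (i - e) 0; apply/orP; [left|right];
  apply/Fp_arcP; exists (i - e) => //; lia.
Qed.

End FpArc.

(** * Orbits under dilation, and digit counts for those that miss an arc *)

Lemma unhitP (V : finType) (T : V -> V) (B : {set V}) (n : nat) (x : V) :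
  reflect (forall i, (i <= n)%N -> iter i T x \notin B) (x \in unhit T B n).
Proof.
rewrite inE; apply: (iffP hasPn) => [xB i le_in|xB _ /trajectP[i le_in ->]].
  by apply: xB; apply/trajectP; exists i.
exact: xB.
Qed.

Lemma eq_hit_parity (V : finType) (T : V -> V) (B : {set V}) (n : nat)
    (x y : V) :
  (forall i, (i < n.+1)%N -> (iter i T x \in B) = (iter i T y \in B)) ->
  hit_parity T B n x = hit_parity T B n y.
Proof.
rewrite /hit_parity => xy; congr odd.
move: n.+1 xy => N; elim: N x y => //= N IHN x y xy.
rewrite (xy 0%N) //; case: ifP => // _; congr _.+1.
apply: IHN => i lt_iN; rewrite -!iterSr; exact: xy.
Qed.

Lemma iter_mulrz (G : zmodType) (m : int) (i : nat) (x : G) :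
  iter i (fun y => y *~ m) x = x *~ (m ^+ i).
Proof. by elim: i => [|i IHi] //=; rewrite IHi exprSr mulrzA. Qed.

Lemma card_bigcup_le (I V : finType) (F : I -> {set V}) (k : nat) :
  (forall i, #|F i| <= k)%N -> (#|\bigcup_i F i| <= #|I| * k)%N.
Proof.
move=> Fk; apply: leq_trans (_ : \sum_(i : I) k <= _)%N; last first.
  by rewrite sum_nat_const.
elim/big_ind2: _ => [|A a C c Aa Cc|i _]; rewrite ?cards0 //.
by apply: leq_trans (leq_card_setU _ _).1 _; apply: leq_add.
Qed.

Lemma Fp_nat_repr (p : nat) (x : 'F_p) : prime p ->
  exists2 a, (a < p)%N & x = a%:R.
Proof.
move=> pr_p; exists (val x); last by rewrite natr_Zp.
by rewrite -[X in (_ < X)%N](Fp_cast pr_p) ltn_ord.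
Qed.

Fixpoint nonzero_digit_nats (q n : nat) : seq nat :=
  if n is n'.+1 then
    [seq (q * t + a)%N | t <- nonzero_digit_nats q n', a <- iota 1 q.-1]
  else [:: 0%N].

Lemma size_nonzero_digit_nats (q n : nat) :
  size (nonzero_digit_nats q n) = (q.-1 ^ n)%N.
Proof. by elim: n => //= n IHn; rewrite size_allpairs IHn size_iota expnSr. Qed.

(* The base-[q] digits of [q ^ n * x %/ p] are the first [n] digits of [x / p]. *)
Lemma mem_nonzero_digit_nats (p q n x : nat) : (x < p)%N ->
  (forall j, (j < n)%N -> p <= q * ((q ^ j * x) %% p))%N ->
  ((q ^ n * x) %/ p)%N \in nonzero_digit_nats q n.
Proof.
move=> lt_xp; have p_gt0 : (0 < p)%N by lia.
elim: n => [|n IHn] dig; first by rewrite mul1n divn_small.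
have {IHn} IHn := IHn (fun j lt_jn => dig j (leqW lt_jn)).
have /= := dig n (ltnSn n); set r := ((q ^ n * x) %% p)%N => le_p.
(* The next digit is [(q * r) %/ p]; it is nonzero exactly because [p <= q * r]. *)
apply/allpairsP; exists ((q ^ n * x) %/ p, (q * r) %/ p)%N => /=; split => //.
  have lt_rp : (r < p)%N by rewrite ltn_mod.
  have q_gt0 : (0 < q)%N by case: (q) le_p; rewrite ?mul0n //; lia.
  have : (q * r %/ p < q)%N by rewrite ltn_divLR // ltn_pmul2l.
  have : (0 < q * r %/ p)%N by rewrite divn_gt0.
  by rewrite mem_iota; lia.
by rewrite expnS -mulnA {1}(divn_eq (q ^ n * x) p) mulnDr mulnA divnMDl.
Qed.

(** At time [k * j] the orbit is at [q ^ j] times [x], and missing the arc there makes the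
    corresponding digit of [x / p] nonzero. This leaves [q.-1 ^ N] strings of [N] digits, each
    shared by few residues. *)
Lemma card_unhit_Fp_arc (p q k N n : nat) (m : int) : prime p -> (0 < q)%N ->
  m ^+ k = q%:Z -> (k * N <= n)%N ->
  (#|unhit (fun x : 'F_p => x *~ m) (Fp_arc p 0 (p %/ q).+1) n|
     <= q.-1 ^ N * (p %/ q ^ N + 2))%N.
Proof.
move=> pr_p q_gt0 mk le_n; set E := unhit _ _ _; have p_gt0 := prime_gt0 pr_p.
(* The residues with digit string [t] lie in a real interval of length [p / q ^ N] starting at
   [t * p / q ^ N]; rounding both quantities down costs the extra [2]. *)
pose s : seq 'F_p := [seq ((t * p) %/ q ^ N + j)%:R
  | t <- nonzero_digit_nats q N, j <- iota 0 (p %/ q ^ N + 2)].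
rewrite -size_nonzero_digit_nats -[X in (_ <= _ * X)%N](size_iota 0).
rewrite -(size_allpairs (fun t j => ((t * p) %/ q ^ N + j)%:R : 'F_p)) -/s.
apply: leq_trans (card_size s); apply/subset_leq_card/subsetP => x xE.
have [a lt_ap xa] := Fp_nat_repr x pr_p.
have digits j : (j < N)%N -> (p <= q * ((q ^ j * a) %% p))%N.
  move=> lt_jN; rewrite leqNgt; apply/negP => small.
  have /unhitP/(_ (k * j)%N) := xE; rewrite iter_mulrz exprM mk => nB.
  have /negP := nB (leq_trans (leq_mul (leqnn k) (ltnW lt_jN)) le_n); apply.
  apply/Fp_arcP; exists ((q ^ j * a) %% p)%N%:Z.
    by rewrite add0r ltz_nat ltnS leq_divRL //= mulnC ltnW.
  have -> : q%:Z ^+ j = (q ^ j)%N%:Z by rewrite -!natz natrX.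
  rewrite xa -!pmulrn -mulrnA [in LHS]mulnC.
  by apply/val_inj; rewrite /= !val_Fp_nat // modn_mod.
have qN_gt0 : (0 < q ^ N)%N by rewrite expn_gt0 q_gt0.
have := mem_nonzero_digit_nats lt_ap digits.
have := divn_eq (q ^ N * a) p; have := ltn_pmod (q ^ N * a) p_gt0.
set t := ((q ^ N * a) %/ p)%N; set r := ((q ^ N * a) %% p)%N => lt_rp def_t tL.
have := divn_eq (t * p) (q ^ N); have := ltn_pmod (t * p) qN_gt0.
have := divn_eq p (q ^ N); have := ltn_pmod p qN_gt0.
set u := ((t * p) %/ q ^ N)%N; set v := (p %/ q ^ N)%N => h1 h2 h3 h4.
have le_ua : (u <= a)%N by nia.
have lt_a : (a < u + v + 2)%N by nia.
apply/allpairsP; exists (t, a - u)%N; split => //=; last by rewrite subnKC.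
by rewrite mem_iota; lia.
Qed.

(** * Sets whose sumset misses an arc, and the case of small dilations *)

Lemma dilate_avoiding_Fp_arc (p b w n : nat) (m : int) : prime p ->
  (0 < `|m| < p)%N -> (w <= p)%N ->
  exists A : {set 'F_p},
    (p <= 2 * #|A| + b + #|unhit (fun x : 'F_p => x *~ m) (Fp_arc p 0 b) n|
          + 2 * (n.+1 * (4 * (`|m| ^ n * w))))%N /\
    (#|sumset A (dilate (- m) A)| + w <= p)%N.
Proof.
move=> pr_p /andP[m_gt0 lt_mp] le_wp; set T := fun x : 'F_p => _.
(* A translation by [c] in [[0, w)] becomes one by [c * m ^ i] after [i <= n] steps, so [W] bounds
   every displacement. *)
set B := Fp_arc p 0 b; set W := (`|m| ^ n * w)%N.
have m_neq0 : m%:~R != 0 :> 'F_p.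
  have p0 k : (0 < k < p)%N -> k%:R != 0 :> 'F_p.
    move=> k_p; apply/eqP => /(congr1 val).
    rewrite /= val_Fp_nat // modn_small; lia.
  have := p0 _ (introT andP (conj m_gt0 lt_mp)).
  by case: (intP m) => // k; rewrite ?rmorphN ?oppr_eq0 /= -?pmulrn ?abszN.
have injT : injective T.
  move=> x y; rewrite /T -[x *~ m]mulrzr -[y *~ m]mulrzr.
  exact: mulIf m_neq0 _ _.
pose edge : {set 'F_p} :=
  Fp_arc p (- W%:Z) (2 * W) :|: Fp_arc p (b%:Z - W%:Z) (2 * W).
pose D := \bigcup_(i : 'I_n.+1) (iter i T @^-1: edge).
pose f := hit_parity T B n.
have cD : (#|D| <= n.+1 * (4 * W))%N.
  rewrite -[n.+1]card_ord; apply: card_bigcup_le => i.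
  rewrite on_card_preimset; last first.
    apply: onW_bij; apply: injF_bij; elim: (val i) => //= j; exact: inj_comp.
  apply: leq_trans (leq_card_setU _ _).1 _.
  apply: leq_trans (leq_add (card_Fp_arc_le _ _ _) (card_Fp_arc_le _ _ _)) _.
  by lia.
have fD z c : z \notin D -> c \in Fp_arc p 0 w -> f (z + c) = f z.
  move=> zD /Fp_arcP[j j_w ->]; apply/esym/eq_hit_parity => i le_in.
  apply/eqP/negPn/negP => neq; case/negP: zD.
  apply/bigcupP; exists (inord i) => //; rewrite inE inordK //.
  move: neq; rewrite !iter_mulrz mulrzDl -mulrzA; apply: Fp_arc_edge.
  rewrite abszM abszX mulnC; apply: leq_mul; last by lia.
  by apply: leq_pexp2l.
pose G := [set x | f x && ~~ f (T x)].
(* The preimage of [D] is removed rather than [D], because invariance under translation is applied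
   at [T y]. *)
exists (G :\: T @^-1: D); set A := _ :\: _; split.
  have le_p := card_hit_parity_descent B n injT.
  rewrite -/f -/G card_Fp // in le_p.
  have def_G := cardsID (T @^-1: D) G; rewrite -/A in def_G.
  have le_I := subset_leq_card (subsetIr G (T @^-1: D)).
  rewrite (on_card_preimset (onW_bij _ (injF_bij injT))) in le_I.
  have arith (g a i d c u M : nat) : (p <= 2 * g + c + u -> i + a = g -> i <= d ->
    d <= M -> c <= b -> p <= 2 * a + b + u + 2 * M)%N by lia.
  exact: arith le_p def_G le_I cD (card_Fp_arc_le _ _ _).
rewrite -[in X in (_ + X)%N](card_Fp_arc 0 pr_p le_wp).
rewrite -[X in (_ <= X)%N](card_Fp pr_p).
rewrite -[X in (_ <= X)%N](cardsC (Fp_arc p 0 w)) addnC leq_add2l.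
apply/subset_leq_card/subsetP => c /imset2P[x _ xA /imsetP[y yA ->] def_c].
rewrite inE; apply/negP => cC.
have def_x : x = T y + c by rewrite def_c mulrNz addrC subrK.
move: xA yA; rewrite !inE -!/(f _) => /and3P[_ fx _] /and3P[TyD _ /negP]; apply.
by rewrite -(fD (T y) c) // -def_x.
Qed.

(** For [lambda = -1] the sums come from integers in [(-a, a)], otherwise from [[0, 2 * a)]. *)
Lemma sumset_dilate_Fp_arc (p a : nat) (lambda : int) : (`|lambda| <= 1)%N ->
  (#|sumset (Fp_arc p 0 a) (dilate lambda (Fp_arc p 0 a))| <= 2 * a)%N.
Proof.
move=> lambda_le1.
apply: leq_trans (card_Fp_arc_le p (if lambda < 0 then - a%:Z else 0) (2 * a)).
apply/subset_leq_card/subsetP.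
move=> _ /imset2P[_ _ /Fp_arcP[i i_a ->] /imsetP[_ /Fp_arcP[j j_a ->] ->] ->].
apply/Fp_arcP; exists (i + j * lambda); last by rewrite rmorphD /= mulrzA.
have : [\/ lambda = -1, lambda = 0 | lambda = 1].
  have : lambda = -1 \/ lambda = 0 \/ lambda = 1 by lia.
  by case=> [|[]] ?; [constructor 1 | constructor 2 | constructor 3].
by case=> ->; rewrite ?ltrN10 ?ltxx ?ltr10; lia.
Qed.

(** * Real estimates and choice of parameters *)

Lemma natr_divn_le (R : numFieldType) (n d : nat) :
  (n %/ d)%:R <= n%:R / d%:R :> R.
Proof.
have [->|d_gt0] := posnP d; first by rewrite divn0 invr0 mulr0.
by rewrite ler_pdivlMr ?ltr0n // -natrM ler_nat leq_divM.
Qed.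

(** Induction works since [(1 - x) * (1 + (n + 1) * x) <= 1 + n * x]. *)
Lemma bernoulli_sub (R : realDomainType) (x : R) (n : nat) : 0 <= x <= 1 ->
  (1 - x) ^+ n * (1 + n%:R * x) <= 1.
Proof.
move=> x01; elim: n => [|n IHn]; first by rewrite expr0; lra.
apply: le_trans IHn; rewrite exprSr -mulrA ler_wpM2l ?exprn_ge0 //; first by lra.
have n_ge0 : 0 <= n%:R :> R by exact: ler0n.
by rewrite -[n.+1]addn1 natrD; nra.
Qed.

Lemma exists_dense_small_sumset_unit_dilate (R : realType) (lambda : int) (eps : R) :
    0 < eps <= 4^-1 -> (`|lambda| <= 1)%N ->
  exists2 delta : R, 0 < delta &
    exists N : nat, forall p : nat, prime p -> (N <= p)%N ->
      exists A : {set 'F_p},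
        (2^-1 - eps) * p%:R <= #|A|%:R /\
        #|sumset A (dilate lambda A)|%:R <= (1 - delta) * p%:R.
Proof.
move=> /andP[eps_gt0 eps_le] lambda_le1; exists eps => //.
exists (Num.bound (2 / eps)) => p pr_p le_Np.
have p_large : 2 <= eps * p%:R.
  rewrite mulrC -ler_pdivrMr //; apply: ltW.
  have /archi_boundP/lt_le_trans : 0 <= 2 / eps by rewrite divr_ge0 // ltW.
  by apply; rewrite ler_nat.
(* Rounding up adds at most [1] to [x], hence [2] to the sumset bound; [eps * p] absorbs this. *)
set x := (2^-1 - eps) * p%:R; pose a := (Num.truncn x).+1.
have x_ge0 : 0 <= x by rewrite mulr_ge0 ?ler0n //; lra.
have /andP[le_ax lt_xa] := truncn_itv x_ge0; rewrite -/a in lt_xa.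
have le_a : 2 * a%:R <= (1 - eps) * p%:R.
  by rewrite /a -[_.+1]addn1 natrD /x in le_ax *; lra.
exists (Fp_arc p 0 a); rewrite card_Fp_arc //; last first.
  rewrite -(ler_nat R); have := ler0n R p; have := ler0n R a; nra.
split; first exact: ltW.
by apply: le_trans le_a; rewrite -natrM ler_nat sumset_dilate_Fp_arc.
Qed.

Lemma exists_power_decay (R : archiRealFieldType) (x eps : R) :
  0 < x <= 1 -> 0 < eps -> exists n : nat, (1 - x) ^+ n <= eps.
Proof.
move=> /andP[x_gt0 x_le1] eps_gt0; exists (Num.bound (eps^-1 / x)).
set n := Num.bound _.
have n_large : eps^-1 < n%:R * x.
  by rewrite -ltr_pdivrMr // archi_boundP // divr_ge0 ?invr_ge0 // ltW.
have := @bernoulli_sub _ x n; rewrite (ltW x_gt0) x_le1 => /(_ isT) bern.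
have pow_ge0 : 0 <= (1 - x) ^+ n by rewrite exprn_ge0 //; lra.
rewrite -(ler_pM2r (_ : 0 < eps^-1)) ?invr_gt0 // mulfV ?gt_eqF //.
apply: le_trans bern; apply: ler_wpM2l => //; lra.
Qed.

(** The allowed loss is [2 * eps * p]: a quarter of [eps * p] for the arc, a quarter for unhit
    orbits, half for the edges, and all of [eps * p] for the constant [c]. *)
Lemma exists_dense_small_sumset_large_dilate (R : realType) (lambda : int) (eps : R) :
    0 < eps -> (1 < `|lambda|)%N ->
  exists2 delta : R, 0 < delta &
    exists N : nat, forall p : nat, prime p -> (N <= p)%N ->
      exists A : {set 'F_p},
        (2^-1 - eps) * p%:R <= #|A|%:R /\
        #|sumset A (dilate lambda A)|%:R <= (1 - delta) * p%:R.
Proof.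
move=> eps_gt0 lambda_gt1.
pose m := - lambda; have mE : `|m|%N = `|lambda|%N by rewrite abszN.
(* The even exponent makes [m ^+ (2 * h)] positive, whatever the sign of [m]. *)
pose h := Num.bound (4 / eps); pose q := (`|m| ^ (2 * h))%N.
have q_gt0 : (0 < q)%N by rewrite expn_gt0; lia.
have mq : m ^+ (2 * h) = q%:Z.
  by rewrite /q -natz natrX natz abszE !exprM (real_normK (num_real _)).
have q_large : 4 / eps <= q%:R.
  apply: ltW; apply: lt_le_trans (_ : h%:R <= _).
    by rewrite archi_boundP // divr_ge0 // ltW.
  rewrite ler_nat ltnW //; apply: leq_trans (ltn_expl h lambda_gt1) _.
  by rewrite /q mE leq_pexp2l; lia.
have qR_gt0 : 0 < q%:R :> R by rewrite ltr0n.
have q_inv : 0 < (q%:R : R)^-1 <= 1 by rewrite invr_gt0 qR_gt0 invf_le1 // ler1n.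
have q_small : q%:R^-1 <= eps / 4.
  by rewrite -[eps / 4]invrK lef_pV2 ?posrE ?invr_gt0 ?divr_gt0 // invf_div.
have [M decay] := exists_power_decay q_inv (divr_gt0 eps_gt0 (ltr0Sn R 3)).
pose n := (2 * h * M)%N; pose K := (n.+1 * (4 * `|m| ^ n))%N.
pose P := (Num.bound (4 * K%:R / eps)).+1.
have P_large : 4 * K%:R <= eps * P%:R.
  rewrite mulrC [eps * _]mulrC -ler_pdivrMr // mulrC; apply: ltW.
  have /archi_boundP/lt_le_trans : 0 <= 4 * K%:R / eps.
    by rewrite divr_ge0 ?mulr_ge0 // ltW.
  by apply; rewrite ler_nat.
have P_gt0 : 0 < P%:R :> R by rewrite ltr0n.
pose c : R := 1 + 2 * q.-1%:R ^+ M.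
have c_ge0 : 0 <= c by rewrite addr_ge0 ?mulr_ge0 ?exprn_ge0.
(* The missed arc has length [p %/ P], at least [p / P - 1], which is at least [p / (2 * P)] once
   [p >= 2 * P]. *)
exists (2 * P%:R)^-1; first by rewrite invr_gt0 mulr_gt0.
exists (maxn `|m|.+1 (maxn (2 * P) (Num.bound (c / eps)))) => p pr_p.
rewrite !geq_max => /and3P[lt_mp le_Pp le_cp].
have p_large : c <= eps * p%:R.
  rewrite mulrC -ler_pdivrMr //; apply: ltW.
  apply: lt_le_trans (archi_boundP _) _; last by rewrite ler_nat.
  by rewrite divr_ge0 // ltW.
pose w := (p %/ P)%N.
have [||A [cA cS]] := @dilate_avoiding_Fp_arc p (p %/ q).+1 w n m pr_p.
- by rewrite lt_mp andbT; lia.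
- exact: leq_div.
exists A; rewrite opprK in cS; split.
  have E_le := card_unhit_Fp_arc pr_p q_gt0 mq (leqnn _ : 2 * h * M <= n)%N.
  set E := #|unhit _ _ _| in cA E_le.
  have : p%:R <= 2 * #|A|%:R + (1 + (p %/ q)%:R) + E%:R + 2 * (K%:R * w%:R) :> R.
    rewrite -[1]/1%:R -!natrM -!natrD ler_nat.
    by apply: leq_trans cA _; rewrite /K; lia.
  have : E%:R <= (1 - q%:R^-1) ^+ M * p%:R + 2 * q.-1%:R ^+ M :> R.
    have -> : (1 - q%:R^-1) ^+ M = q.-1%:R ^+ M / q%:R ^+ M :> R.
      rewrite -expr_div_n -[in 1 - _](prednK q_gt0) -natr1; congr (_ ^+ _).
      by rewrite -[in RHS](prednK q_gt0) -natr1; field; rewrite natr1 pnatr_eq0.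
    move: E_le; rewrite -(ler_nat R) natrM natrX natrD => /le_trans; apply.
    rewrite mulrDr [2 * _]mulrC lerD2r -mulrA ler_wpM2l ?exprn_ge0 //.
    by rewrite mulrC -natrX natr_divn_le.
  have : K%:R * w%:R <= eps / 4 * p%:R.
    apply: le_trans (ler_wpM2l (ler0n _ K) (natr_divn_le R p P)) _.
    rewrite mulrCA mulrC ler_wpM2r // ler_pdivrMr //; lra.
  have : (p %/ q)%:R <= eps / 4 * p%:R.
    apply: le_trans (natr_divn_le R p q) _.
    by rewrite mulrC ler_wpM2r.
  have := ler_wpM2r (ler0n R p) decay.
  rewrite /c in p_large; lra.
have P_le_p : 2 * P%:R <= p%:R :> R by rewrite -natrM ler_nat.
have w_large : p%:R / P%:R - 1 <= w%:R :> R.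
  rewrite lerBlDr natr1 ler_pdivrMr // -natrM ler_nat ltnW //.
  by rewrite ltn_ceil.
have half : 1 <= (2 * P%:R)^-1 * p%:R :> R.
  by rewrite mulrC ler_pdivlMr ?mul1r // mulr_gt0.
have : p%:R / P%:R = 2 * ((2 * P%:R)^-1 * p%:R) :> R by field; rewrite gt_eqF.
move: cS; rewrite -(ler_nat R) natrD; lra.
Qed.

Theorem theorem2 (R : realType) (lambda : int) (eps : R) (eps_gt0 : 0 < eps) :
  exists2 delta : R, 0 < delta &
    exists N : nat, forall p : nat, prime p -> (N <= p)%N ->
      exists A : {set 'F_p},
        (2^-1 - eps) * p%:R <= #|A|%:R /\
        #|sumset A (dilate lambda A)|%:R <= (1 - delta) * p%:R.
Proof.
have [lambda_le1|] := leqP `|lambda| 1; last exact: exists_dense_small_sumset_large_dilate.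
(* Capping [eps] at [1 / 4] only strengthens the density bound. *)
have [|delta delta_gt0 [N small]] :=
  @exists_dense_small_sumset_unit_dilate R lambda (Num.min eps 4^-1) _ lambda_le1.
  by rewrite lt_min eps_gt0 ge_min lexx orbT invr_gt0 ltr0n.
exists delta => //; exists N => p pr_p /(small p pr_p)[A [cA cS]].
exists A; split => //; apply: le_trans cA; apply: ler_wpM2r => //.
by rewrite lerD2l lerN2 ge_min lexx.
Qed.
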